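(* The generating function $\Phi(x,y)$ of Tamari intervals satisfies the functional equation $$\Phi(x,y)=\mathrm{B}(\Phi,\Phi)+1,\qquad\text{where}\qquad \mathrm{B}(f,g):=xy\,f(x,y)\,\frac{x\,g(x,y)-g(1,y)}{x-1}.$$
   Context: A binary tree is planar: either the empty tree or a root node with an ordered pair (left subtree, right subtree) of binary trees; $x(A,B)$ denotes the tree with root $x$ and left/right subtrees $A,B$. The size is the number of nodes. The Tamari order on binary trees of size $n$ is the reflexive transitive closure of right rotation, which replaces a subtree $y(x(A,B),C)$ by $x(A,y(B,C))$; the tree after rotation is greater. The leftmost branch of a tree consists of the nodes reached from the root by following only left edges, root included ($0$ nodes for the empty tree). $\Phi(x,y):=\sum_{n,k\ge 0}I_{n,k}\,x^k y^n$, where $I_{n,k}$ is the number of intervals $[T_1,T_2]$ (pairs $T_1\le T_2$) of binary trees of size $n$ such that $T_1$ has exactly $k$ nodes on its leftmost branch; the interval of size $0$ is counted, so $\Phi=1+xy+(x+2x^2)y^2+\cdots$, a formal power series in $y$ with polynomial coefficients in $x$. *)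

(* Defs.v *)
From HB Require Import structures.
From mathcomp Require Import all_boot all_order all_algebra.

Set Implicit Arguments.
Unset Strict Implicit.
Unset Printing Implicit Defensive.

Import GRing.Theory.

Inductive bintree : Type := Empty | Node of bintree & bintree.

Fixpoint gentree_of_bintree (t : bintree) : GenTree.tree unit :=
  if t is Node a b
  then GenTree.Node 1 [:: gentree_of_bintree a; gentree_of_bintree b]
  else GenTree.Node 0 [::].

Fixpoint bintree_of_gentree (g : GenTree.tree unit) : bintree :=
  if g is GenTree.Node 1 [:: a; b]
  then Node (bintree_of_gentree a) (bintree_of_gentree b)
  else Empty.

Lemma gentree_of_bintreeK : cancel gentree_of_bintree bintree_of_gentree.
Proof. by elim=> //= a -> b ->. Qed.

HB.instance Definition _ := Countable.copy bintree (can_type gentree_of_bintreeK).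

Fixpoint tsize (t : bintree) : nat :=
  if t is Node a b then (tsize a + tsize b).+1 else 0.

Fixpoint leftmost (t : bintree) : nat :=
  if t is Node a _ then (leftmost a).+1 else 0.

Fixpoint rotations (t : bintree) : seq bintree :=
  if t is Node l r then
    (if l is Node a b then [:: Node a (Node b r)] else [::])
      ++ [seq Node l' r | l' <- rotations l]
      ++ [seq Node l r' | r' <- rotations r]
  else [::].

Lemma tsize_rotations t t' : t' \in rotations t -> tsize t' = tsize t.
Proof.
elim: t t' => //= l IHl r IHr t'; rewrite !mem_cat => /or3P[].
- case: l {IHl} => // a b; rewrite inE => /eqP -> /=.
  by rewrite addnS addSn addnA.
- by case/mapP=> l' /IHl el -> /=; rewrite el.
- by case/mapP=> r' /IHr er -> /=; rewrite er.
Qed.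

Lemma leftmost_le_tsize t : leftmost t <= tsize t.
Proof. by elim: t => //= a IHa b _; rewrite ltnS (leq_trans IHa) ?leq_addr. Qed.

Record tree_of (n : nat) : Type :=
  TreeOf { tree_val :> bintree; tree_size : tsize tree_val == n }.

HB.instance Definition _ n := [isSub for @tree_val n].
HB.instance Definition _ n := [Countable of tree_of n by <:].

Fixpoint trees_upto (h : nat) : seq bintree :=
  if h is h'.+1
  then Empty :: [seq Node a b | a <- trees_upto h', b <- trees_upto h']
  else [:: Empty].

Lemma mem_trees_upto h t : tsize t <= h -> t \in trees_upto h.
Proof.
elim: h t => [|h IHh] [|a b] //=; rewrite ltnS => le_h.
rewrite inE; apply/orP; right; apply/allpairsP; exists (a, b); split=> //=.
  by apply: IHh; apply: leq_trans le_h; rewrite leq_addr.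
by apply: IHh; apply: leq_trans le_h; rewrite leq_addl.
Qed.

Definition tree_of_enum n : seq (tree_of n) :=
  undup (pmap insub (trees_upto n)).

Lemma tree_of_enumP n : Finite.axiom (tree_of_enum n).
Proof.
move=> t; rewrite count_uniq_mem ?undup_uniq // mem_undup mem_pmap_sub.
by rewrite mem_trees_upto // (eqP (tree_size t)).
Qed.

HB.instance Definition _ n := isFinite.Build (tree_of n) (@tree_of_enumP n).

Definition rotation n : rel (tree_of n) :=
  [rel t1 t2 | tree_val t2 \in rotations (tree_val t1)].

Definition tamari n : rel (tree_of n) := connect (@rotation n).

Definition interval_count (n k : nat) : nat :=
  #|[set p : tree_of n * tree_of n | tamari p.1 p.2 & leftmost p.1 == k]|.

Lemma interval_count_eq0 n k : n < k -> interval_count n k = 0.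
Proof.
move=> lt_nk; apply/eqP; rewrite cards_eq0; apply/eqP/setP=> -[t1 t2].
rewrite !inE /=; apply/negP=> /andP[_ /eqP ek].
have := leftmost_le_tsize t1; rewrite ek (eqP (tree_size t1)).
by rewrite leqNgt lt_nk.
Qed.

Local Open Scope ring_scope.

(** Elements of Z[x][[y]]: [f n] is the coefficient of [y ^ n], a polynomial in [x = 'X]. *)
Definition series := nat -> {poly int}.

Definition sconst (p : {poly int}) : series :=
  fun n => if n == 0%N then p else 0.

Definition sx : series := sconst 'X.

Definition sy : series := fun n => (n == 1%N)%:R.

Definition sadd (f g : series) : series := fun n => f n + g n.

Definition ssub (f g : series) : series := fun n => f n - g n.

Definition smul (f g : series) : series :=
  fun n => \sum_(i < n.+1) f i * g (n - i)%N.

Definition at_x1 (g : series) : series := fun n => (g n).[1]%:P.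

(** Coefficientwise quotient by the monic polynomial [x - 1]; it is a genuine
    quotient when every coefficient is divisible by [x - 1], as in [sB_exact]. *)
Definition div_x1 (h : series) : series := fun n => h n %/ ('X - 1).

Definition sB (f g : series) : series :=
  smul (smul (smul sx sy) f) (div_x1 (ssub (smul sx g) (at_x1 g))).

Lemma smul_sconst p f n : smul (sconst p) f n = p * f n.
Proof.
rewrite /smul big_ord_recl /= subn0 big1 ?addr0 // => i _.
by rewrite /sconst /= mul0r.
Qed.

Lemma sB_exact g :
  smul (sconst ('X - 1)) (div_x1 (ssub (smul sx g) (at_x1 g)))
    =1 ssub (smul sx g) (at_x1 g).
Proof.
move=> n; rewrite smul_sconst /div_x1 mulrC.
apply: Pdiv.IdomainUnit.divpK; first by rewrite -polyC1 lead_coefXsubC unitr1.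
rewrite -polyC1 Pdiv.Idomain.dvdp_XsubCl /ssub smul_sconst /at_x1.
by rewrite rootE hornerD hornerN hornerC hornerM hornerX mul1r subrr.
Qed.

(** The inner sum over [k] may stop at [n] by [interval_count_eq0]; see
    [coef_Phi] for all the coefficients. *)
Definition Phi : series :=
  fun n => \sum_(k < n.+1) (interval_count n k)%:R *: 'X^k.

Lemma coef_Phi n k : (Phi n)`_k = (interval_count n k)%:R.
Proof.
rewrite /Phi -(poly_def n.+1 (fun k => (interval_count n k)%:R)) coef_poly.
by case: ltnP => // /interval_count_eq0 ->.
Qed.

(* Main.v *)
Require Import Defs.
From mathcomp Require Import all_boot all_order all_algebra.
Local Open Scope ring_scope.

Set Implicit Arguments.
Unset Strict Implicit.
Unset Printing Implicit Defensive.

(* [tsize] is to be the size of a tree again, not the function on tuples. *)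
Import Defs GRing.Theory.

(** The coefficient of [y ^ n.+1] in [B(Phi, Phi)] is computed by a bijection.

    Write [t . u] for [graft t u], the tree [u] with [t] hung on its leftmost
    leaf: an associative product for which [tsize] and [leftmost] are additive.
    Splitting off the first node in inorder writes each nonempty tree uniquely
    as [first_graft b r], that is, [b] as right subtree of a single node, then
    [. r].  The Tamari order reads as follows on this form
    ([tamari_first_graft] and its converse [tamari_first_graftP]):
    [first_graft b r <= first_graft b' r'] if and only if [r = r1 . r2] with
    [b . r1 <= b'] and [r2 <= r'].  Indeed a rotation that involves the first
    node enlarges its right subtree [b] by an initial factor of [r], and the
    other rotations take place inside a factor.

    So an interval of size [n.+1] amounts to two intervals [r2 <= r'] and
    [s <= b'] of total size [n], with a factorization [s = b . r1].  The
    factorizations of [s] cut its leftmost branch, and are thus indexed by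
    [j = leftmost r1], from [0] to [leftmost s] ([perm_glue]); the lower end
    of the glued interval has [1 + leftmost r2 + j] nodes on its leftmost
    branch ([leftmost_glue]).  The sum of [x ^ j] over [j] from [0] to
    [k = leftmost s] is [(x * x ^ k - 1) / (x - 1)], the image of [x ^ k] under
    the operator [g |-> (x g(x) - g(1)) / (x - 1)] in the second argument of
    [B] ([div_x1_monomials]); the factor [x y] accounts for the first node. *)

(** * Grafting on the leftmost leaf *)

Fixpoint graft (t u : bintree) : bintree :=
  if u is Node a b then Node (graft t a) b else t.

Lemma graft0t t : graft Empty t = t.
Proof. by elim: t => //= a -> b _. Qed.

Lemma graftA t u v : graft t (graft u v) = graft (graft t u) v.
Proof. by elim: v => //= a -> b _. Qed.

Lemma tsize_graft t u : tsize (graft t u) = (tsize t + tsize u)%N.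
Proof. by elim: u => [|a /= -> b _]; rewrite ?addn0 // addnS addnA. Qed.

Lemma leftmost_graft t u :
  leftmost (graft t u) = (leftmost t + leftmost u)%N.
Proof. by elim: u => [|a /= -> b _]; rewrite ?addn0 ?addnS. Qed.

(** The sizes of the factors fix the place of the cut on the leftmost branch,
    so that a factorization is determined by the size of its left factor. *)
Lemma graft_inj t u t' u' :
  tsize t = tsize t' -> graft t u = graft t' u' -> t = t' /\ u = u'.
Proof.
move=> st; elim: u u' => [|a IHa b _] [|a' b'] /=.
- by [].
- move=> e; move: st; rewrite e /= tsize_graft -addnA -addnS => /eqP.
  by rewrite -{2}[tsize t']addn0 eqn_add2l.
- move=> e; move: st; rewrite -e /= tsize_graft -addnA -addnS => /eqP.
  by rewrite -{1}[tsize t]addn0 eqn_add2l.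
- by case=> /IHa[-> ->] ->.
Qed.

(** Nonempty trees are read from their first node in inorder, the bottom of the
    leftmost branch: [b] is the right subtree of this node. *)
Definition first_graft (b r : bintree) : bintree := graft (Node Empty b) r.

Lemma first_graft_inj b r b' r' :
  first_graft b r = first_graft b' r' -> b = b' /\ r = r'.
Proof.
have neq0 c a : Empty <> first_graft c a.
  by move/(congr1 tsize); rewrite tsize_graft.
elim: r r' => [|p IHp q _] [|p' q'] //=.
- by case.
- by case=> /neq0.
- by case=> /esym/neq0.
- by case=> /IHp[-> ->] ->.
Qed.

Lemma first_graftP a c : exists b r, Node a c = first_graft b r.
Proof.
elim: a c => [|a IHa b _] c; first by exists c, Empty.
by have [p [q e]] := IHa b; exists p, (Node q c); rewrite e.
Qed.

Lemma tsize_first_graft b r :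
  tsize (first_graft b r) = (tsize b + tsize r).+1.
Proof. by rewrite tsize_graft. Qed.

(** [branch_top j t] and [branch_bot j t] cut the leftmost branch of [t] below
    its [j] uppermost nodes. *)
Fixpoint branch_top (j : nat) (t : bintree) : bintree :=
  if j is j'.+1 then
    if t is Node a b then Node (branch_top j' a) b else Empty
  else Empty.

Fixpoint branch_bot (j : nat) (t : bintree) : bintree :=
  if j is j'.+1 then
    if t is Node a _ then branch_bot j' a else Empty
  else t.

Lemma graft_branch j t : graft (branch_bot j t) (branch_top j t) = t.
Proof. by elim: j t => [|j IHj] [|a b] //=; rewrite IHj. Qed.

Lemma leftmost_branch_top j t :
  (j <= leftmost t)%N -> leftmost (branch_top j t) = j.
Proof. by elim: j t => [|j IHj] [|a b] //= /IHj ->. Qed.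

Lemma branch_graft t u :
  branch_bot (leftmost u) (graft t u) = t /\
  branch_top (leftmost u) (graft t u) = u.
Proof. by elim: u => [|a [IHb IHt] b _] //=; rewrite IHb IHt. Qed.

(** * The Tamari order on first-node decompositions *)

(** The Tamari order on bare trees, where the grafting lemmas can be stated
    without keeping track of sizes; see [tamariP]. *)
Inductive tamari_le : bintree -> bintree -> Prop :=
| tamari_refl t : tamari_le t t
| tamari_step t u v : u \in rotations t -> tamari_le u v -> tamari_le t v.

Lemma tamari_trans u t v : tamari_le t u -> tamari_le u v -> tamari_le t v.
Proof. by elim=> // {}t {}u w tu _ IH /IH; apply: tamari_step. Qed.

Lemma tamari_rot t u : u \in rotations t -> tamari_le t u.
Proof. by move=> tu; apply: tamari_step tu (tamari_refl u). Qed.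

Lemma tsize_tamari t u : tamari_le t u -> tsize t = tsize u.
Proof. by elim=> // {}t {}u v /tsize_rotations <-. Qed.

Variant rotations_spec (l r : bintree) : bintree -> Prop :=
| RotRoot a b of l = Node a b : rotations_spec l r (Node a (Node b r))
| RotLeft l' of l' \in rotations l : rotations_spec l r (Node l' r)
| RotRight r' of r' \in rotations r : rotations_spec l r (Node l r').

Lemma rotationsP l r t :
  t \in rotations (Node l r) <-> rotations_spec l r t.
Proof.
rewrite /= !mem_cat; split.
  case/or3P.
  - by case: l => // a b; rewrite inE => /eqP ->; apply: RotRoot.
  - by case/mapP=> l' l'P ->; apply: RotLeft.
  - by case/mapP=> r' r'P ->; apply: RotRight.
case=> [a b ->|l' l'P|r' r'P]; apply/or3P.
- by apply: Or31; rewrite inE.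
- by apply: Or32; apply: map_f.
- by apply: Or33; apply: map_f.
Qed.

Arguments rotations : simpl never.

Lemma tamari_node l l' r r' :
  tamari_le l l' -> tamari_le r r' -> tamari_le (Node l r) (Node l' r').
Proof.
move=> ll' rr'; apply: (@tamari_trans (Node l' r)).
  elim: ll' => [t|t u v tu _]; first exact: tamari_refl.
  by apply: tamari_step; apply/rotationsP; apply: RotLeft.
elim: rr' => [t|t u v tu _]; first exact: tamari_refl.
by apply: tamari_step; apply/rotationsP; apply: RotRight.
Qed.

Lemma tamari_graftl t t' u :
  tamari_le t t' -> tamari_le (graft t u) (graft t' u).
Proof.
move=> tt'; elim: u => //= a IHa b _.
by apply: tamari_node IHa (tamari_refl _).
Qed.

Lemma rotation_graftr t u u' :
  u' \in rotations u -> graft t u' \in rotations (graft t u).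
Proof.
elim: u u' => // l IHl r _ u' /rotationsP[a b ->|l' /IHl l'P|r' r'P] /=;
  apply/rotationsP; by [apply: RotRoot|apply: RotLeft|apply: RotRight].
Qed.

Lemma tamari_graft t t' u u' :
  tamari_le t t' -> tamari_le u u' -> tamari_le (graft t u) (graft t' u').
Proof.
move=> tt' uu'; apply: tamari_trans (tamari_graftl u tt') _.
elim: uu' => [w|w v z wv _]; first exact: tamari_refl.
by apply: tamari_step; apply: rotation_graftr.
Qed.

(** The first node can be rotated past the whole leftmost branch of [r], from
    the bottom up; this makes [r] part of its right subtree. *)
Lemma tamari_absorb b r :
  tamari_le (first_graft b r) (Node Empty (graft b r)).
Proof.
elim: r => [|p IHp q _]; first exact: tamari_refl.
apply: tamari_trans (tamari_node IHp (tamari_refl q)) _.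
by apply/tamari_rot/rotationsP; apply: RotRoot.
Qed.

(** The only edge that a product has across its factors is a left edge, and
    undoing a rotation acts on a right edge; so it stays inside one factor. *)
Lemma rotation_to_graft t u v : graft u v \in rotations t ->
  exists u' v', [/\ t = graft u' v', tamari_le u' u & tamari_le v' v].
Proof.
elim: v t => [|a IHa b _] t.
  by move=> tu; exists t, Empty; split=> //; [exact: tamari_rot|exact: tamari_refl].
case: t => // l r /rotationsP /=; move e: (Node _ _) => w lrw.
case: lrw e => [p q -> | l' l'P | r' r'P].
- case=> <- ->; exists u, (Node (Node a q) r); split=> //.
    exact: tamari_refl.
  by apply/tamari_rot/rotationsP; apply: RotRoot.
- case=> el ->; rewrite -el in l'P.
  have [u' [v' [-> uu' vv']]] := IHa _ l'P.
  exists u', (Node v' r); split=> //.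
  exact: tamari_node vv' (tamari_refl _).
- case=> <- eb; exists u, (Node a r); split=> //; first exact: tamari_refl.
  by apply/tamari_node/tamari_rot; [exact: tamari_refl|rewrite eb].
Qed.

(** In the second case the first node itself moves up, past its parent: this
    parent, with its right subtree [c], is the first factor of [r]. *)
Variant first_rotation_spec (b r b' r' : bintree) : Prop :=
| FirstRotIn of b' \in rotations b & r' = r
| FirstRotAt c of b' = Node b c & r = graft (Node Empty c) r'
| FirstRotOut of b' = b & r' \in rotations r.

Lemma first_rotationP b r b' r' :
  first_graft b' r' \in rotations (first_graft b r) ->
  first_rotation_spec b r b' r'.
Proof.
elim: r r' => [|p IHp q _] r'.
  move/rotationsP; move e: (first_graft b' r') => w bw.
  case: bw e => [//|//|c cP]; rewrite -[Node _ _]/(first_graft c Empty).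
  by case/first_graft_inj=> -> ->; apply: FirstRotIn.
move/rotationsP; rewrite -/(graft _ _).
move e: (first_graft b' r') => w bw.
case: bw e => [l m|l'|q' q'P].
- case: p {IHp} => [|p1 p2] /= [].
    move=> <- <-; rewrite -[Node _ _]/(first_graft (Node b q) Empty).
    by case/first_graft_inj=> -> ->; apply: FirstRotAt.
  move=> <- <-; rewrite -[Node _ _]/(first_graft b (Node p1 (Node p2 q))).
  case/first_graft_inj=> -> ->; apply: FirstRotOut => //.
  by apply/rotationsP; apply: RotRoot.
- move=> l'P; case: r' => [|x y] /=.
    by case=> el; move/tsize_rotations: l'P; rewrite -el tsize_graft.
  case=> el <-; rewrite -el in l'P; case: (IHp _ l'P).
  + by move=> bb ->; apply: FirstRotIn.
  + by move=> c -> ->; apply: FirstRotAt.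
  + move=> -> xp; apply: FirstRotOut => //.
    by apply/rotationsP; apply: RotLeft.
- rewrite -[Node _ _]/(first_graft b (Node p q')).
  case/first_graft_inj=> -> ->; apply: FirstRotOut => //.
  by apply/rotationsP; apply: RotRight.
Qed.

Lemma tamari_first_graft b r1 r2 b' r' :
  tamari_le (graft b r1) b' -> tamari_le r2 r' ->
  tamari_le (first_graft b (graft r1 r2)) (first_graft b' r').
Proof.
move=> bb' rr'; rewrite /first_graft graftA; apply: tamari_graft => //.
apply: tamari_trans (tamari_absorb b r1) _.
exact: tamari_node (tamari_refl _) bb'.
Qed.

(** By induction on a chain of rotations, prepending one step at a time: each
    of the three kinds of first step allows a factorization for the end of the
    step to be pulled back to its start. *)
Lemma tamari_first_graftP b r b' r' :
  tamari_le (first_graft b r) (first_graft b' r') ->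
  exists r1 r2,
    [/\ r = graft r1 r2, tamari_le (graft b r1) b' & tamari_le r2 r'].
Proof.
move et: (first_graft b r) => t; move eu: (first_graft b' r') => u tu.
elim: tu b r et eu => {t u} [t|t u v tu _ IH] b r et ev.
  move: et; rewrite -ev => /first_graft_inj[-> ->].
  by exists Empty, r'; rewrite graft0t; split=> //; apply: tamari_refl.
case: u tu IH => [|x y] tu IH.
  by move/tsize_rotations: tu; rewrite -et tsize_graft.
have [c [s eu]] := first_graftP x y.
have [r1 [r2 [es cb rr']]] := IH _ _ (esym eu) ev.
move: tu; rewrite eu -et => /first_rotationP[bc sr|d ec er|cb' sr].
- exists r1, r2; rewrite -sr; split=> //.
  exact: tamari_trans (tamari_graftl _ (tamari_rot bc)) cb.
- exists (graft (Node Empty d) r1), r2; rewrite er es graftA; split=> //.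
  by rewrite graftA /= -ec.
- rewrite es in sr; have [u1 [u2 [-> u1r u2r]]] := rotation_to_graft sr.
  exists u1, u2; split=> //; last exact: tamari_trans u2r rr'.
  apply: tamari_trans cb; rewrite -cb'.
  exact: tamari_graft (tamari_refl _) u1r.
Qed.

(** * Enumerating intervals *)

Definition intervals (n : nat) : seq (bintree * bintree) :=
  [seq (tree_val p.1, tree_val p.2)
     | p <- enum [pred p : tree_of n * tree_of n | tamari p.1 p.2]].

Lemma tamariP n (t u : tree_of n) : tamari t u <-> tamari_le t u.
Proof.
split.
  case/connectP=> p; elim: p t => [|v p IHp] t /= => [_ ->|].
    exact: tamari_refl.
  by case/andP=> tv /IHp IH /IH; apply: tamari_step.
move ea: (tree_val t) => a; move eb: (tree_val u) => b ab.
elim: ab t ea eb => {a b} [a|a b c ab _ IH] t ea eb.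
  have -> : t = u by apply: val_inj; rewrite /= ea eb.
  exact: connect0.
have sb : tsize b == n by rewrite (tsize_rotations ab) -ea tree_size.
apply: connect_trans (IH (TreeOf sb) erefl eb).
by apply: connect1; rewrite /rotation /= ea.
Qed.

Lemma uniq_intervals n : uniq (intervals n).
Proof.
rewrite map_inj_uniq ?enum_uniq // => -[t u] [t' u'] [].
by move=> /val_inj -> /val_inj ->.
Qed.

Lemma mem_intervals n t u :
  (t, u) \in intervals n <-> tsize t = n /\ tamari_le t u.
Proof.
split.
  case/mapP=> -[a b]; rewrite mem_enum inE /= => /tamariP ab [-> ->].
  by split=> //; apply/eqP/tree_size.
case=> st tu; have su := tsize_tamari tu; rewrite st in su.
move/eqP in st; move/esym/eqP in su.
apply/mapP; exists (TreeOf st, TreeOf su) => //.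
by rewrite mem_enum inE; apply/tamariP.
Qed.

Lemma perm_intervals0 : perm_eq (intervals 0) [:: (Empty, Empty)].
Proof.
apply: uniq_perm; rewrite ?uniq_intervals // => -[t u]; rewrite inE.
apply/idP/eqP; last by case=> -> ->; apply/mem_intervals; split; constructor.
case/mem_intervals; case: t => //= _ /tsize_tamari.
by case: u.
Qed.

Lemma Phi_intervals n :
  Phi n = \sum_(p <- intervals n) 'X^(leftmost p.1).
Proof.
apply/polyP=> k; rewrite coef_Phi coef_sum big_map big_enum /=.
under [RHS]eq_bigr => p _ do rewrite coefXn eq_sym.
rewrite /interval_count -sum1_card natr_sum.
under [LHS]eq_bigl => p do rewrite inE.
by rewrite big_mkcondr; apply: eq_bigr => p _; case: eqP.
Qed.

(** * The bijection *)

(** Lists of pairs of intervals of total size [n], then with a cut of the lower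
    end of the second interval; they enumerate the source of the bijection in
    the order in which the right-hand side of the equation is summed. *)
Definition interval_pairs n :=
  [seq q | i <- iota 0 n.+1,
           q <- [seq (p1, p2) | p1 <- intervals i, p2 <- intervals (n - i)]].

Definition cut_pairs n :=
  [seq (q, j) | q <- interval_pairs n, j <- iota 0 (leftmost q.2.1).+1].

(** Here [s] is [b . r1] for [b] and [r1] the parts below and above the cut. *)
Definition glue (c : (bintree * bintree) * (bintree * bintree) * nat) :
    bintree * bintree :=
  let: ((r2, r'), (s, b'), j) := c in
  (first_graft (branch_bot j s) (graft (branch_top j s) r2),
   first_graft b' r').

Lemma mem_interval_pairs n r r' s b' :
  ((r, r'), (s, b')) \in interval_pairs n <->
  [/\ (tsize r + tsize s)%N = n, tamari_le r r' & tamari_le s b'].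
Proof.
split.
  case/allpairsPdep=> i [q [+ + eq]]; rewrite -{}eq mem_iota ltnS => lein.
  case/allpairsP=> -[[x x'] [y y']] [/= /mem_intervals[sx xx'] + [-> -> -> ->]].
  by case/mem_intervals=> -> yy'; split=> //; rewrite sx subnKC.
case=> en rr' sb'; apply/allpairsPdep.
exists (tsize r), ((r, r'), (s, b')); split=> //.
  by rewrite mem_iota ltnS -en leq_addr.
apply/allpairsP; exists ((r, r'), (s, b')); split=> //=; apply/mem_intervals => //.
by rewrite -en addKn.
Qed.

Lemma uniq_interval_pairs n : uniq (interval_pairs n).
Proof.
apply: allpairs_uniq_dep => [|i _|]; first exact: iota_uniq.
  by apply: allpairs_uniq; rewrite ?uniq_intervals // => -[? ?] [? ?].
have size1 i q :
    q \in [seq (p1, p2) | p1 <- intervals i, p2 <- intervals (n - i)] ->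
    tsize q.1.1 = i.
  by case/allpairsP=> -[[x x'] y] [/= /mem_intervals[<- _] _ ->].
move=> u v /allpairsPdep[i [p [_ /size1 pi ->]]].
by move=> /allpairsPdep[j [q [_ /size1 qj ->]]] /= epq; rewrite -pi -qj epq.
Qed.

Lemma mem_cut_pairs n r r' s b' j :
  ((r, r'), (s, b'), j) \in cut_pairs n <->
  [/\ (tsize r + tsize s)%N = n, tamari_le r r', tamari_le s b'
    & (j <= leftmost s)%N].
Proof.
split.
  case/allpairsPdep=> -[[x x'] [y y']] [i [/mem_interval_pairs[en xx' yy']]].
  by rewrite mem_iota ltnS => li [-> -> -> -> ->].
case=> en rr' sb' js; apply/allpairsPdep.
exists ((r, r'), (s, b')), j; split=> //; first exact/mem_interval_pairs.
by rewrite mem_iota ltnS.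
Qed.

Lemma uniq_cut_pairs n : uniq (cut_pairs n).
Proof.
apply: allpairs_uniq_dep => [|q _|]; first exact: uniq_interval_pairs.
  exact: iota_uniq.
by move=> [p i] [q j] _ _ [-> ->].
Qed.

(** The upper end of the glued interval determines [b'] and [r'], hence the
    size of [s], which tells where [r1] stops in [r1 . r2]. *)
Lemma glue_inj n : {in cut_pairs n &, injective glue}.
Proof.
move=> [[[r r'] [s b']] j] [[[x x'] [t c']] i].
case/mem_cut_pairs=> _ _ /tsize_tamari sb js.
case/mem_cut_pairs=> _ _ /tsize_tamari tc it [].
case/first_graft_inj=> eb er /first_graft_inj[ec ->].
(* The sizes of [b] and [b . r1 <= b'] agree on both sides, so that of [r1] does. *)
have [et ->] : branch_top j s = branch_top i t /\ r = x.
  apply: graft_inj er; apply/eqP; rewrite -(eqn_add2l (tsize (branch_bot j s))).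
  by rewrite {2}eb -!tsize_graft !graft_branch sb tc ec.
rewrite -(leftmost_branch_top js) -(leftmost_branch_top it) et ec.
by rewrite -(graft_branch j s) -(graft_branch i t) eb et.
Qed.

Lemma perm_glue n : perm_eq (map glue (cut_pairs n)) (intervals n.+1).
Proof.
apply: uniq_perm; [|exact: uniq_intervals|].
  by rewrite (map_inj_in_uniq (@glue_inj n)) uniq_cut_pairs.
move=> [t u]; apply/idP/idP.
  case/mapP=> -[[[r r'] [s b']] j] /mem_cut_pairs[<- rr' sb' _] [-> ->].
  apply/mem_intervals; split.
    rewrite tsize_first_graft tsize_graft addnA -tsize_graft graft_branch.
    by rewrite addnC.
  by apply: tamari_first_graft; rewrite ?graft_branch.
case/mem_intervals; case: t => // a c st tu.
have [b [r et]] := first_graftP a c; have := tsize_tamari tu; rewrite st.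
case: u tu => // a' c' + _; have [b' [r' eu]] := first_graftP a' c'.
rewrite et eu => /tamari_first_graftP[r1 [r2 [er bb' rr']]].
have [eb e1] := branch_graft b r1.
apply/mapP; exists ((r2, r'), (graft b r1, b'), leftmost r1).
  apply/mem_cut_pairs; split=> //; last by rewrite leftmost_graft leq_addl.
  move: st; rewrite et tsize_first_graft er !tsize_graft => -[<-].
  by rewrite addnC addnA.
by rewrite /= eb e1 er.
Qed.

Lemma leftmost_glue r r' s b' j : (j <= leftmost s)%N ->
  leftmost (glue ((r, r'), (s, b'), j)).1 = (leftmost r + j).+1.
Proof.
move=> js; rewrite /= !leftmost_graft leftmost_branch_top //=.
by rewrite add1n addnC.
Qed.

(** * The functional equation *)

(** Multiplied by [x - 1], both sides are the sum over [i] of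
    [x ^ (k i).+1 - 1], a telescoping geometric sum on the right. *)
Lemma div_x1_monomials (I : Type) (g : series) (l : seq I) (k : I -> nat) n :
  g n = \sum_(i <- l) 'X^(k i) ->
  div_x1 (ssub (smul sx g) (at_x1 g)) n
    = \sum_(i <- l) \sum_(j <- iota 0 (k i).+1) 'X^j.
Proof.
move=> eg; have /mulfI : ('X - 1 : {poly int}) != 0.
  by rewrite -polyC1 polyXsubC_eq0.
apply; rewrite -smul_sconst sB_exact /ssub smul_sconst /at_x1 eg.
rewrite horner_sum rmorph_sum [in LHS]mulr_sumr -sumrB [RHS]mulr_sumr.
apply: eq_bigr => i _.
rewrite hornerXn expr1n rmorph1 -exprS subrX1; congr (_ * _).
by rewrite -[iota _ _]/(index_iota 0 (k i).+1) big_mkord.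
Qed.

Lemma smulS f g n :
  smul f g n.+1 = f 0%N * g n.+1 + smul (fun i => f i.+1) g n.
Proof. by rewrite /smul big_ord_recl subn0. Qed.

Lemma eq_smull f f' g : f =1 f' -> smul f g =1 smul f' g.
Proof. by move=> ff' n; apply: eq_bigr => i _; rewrite ff'. Qed.

Lemma smul_xy f : smul (smul sx sy) f =1
  fun n => if n is m.+1 then 'X * f m else 0.
Proof.
have sxy n : smul sx sy n = 'X * sy n by apply: smul_sconst.
case=> [|n]; first by rewrite /smul big_ord1 -/(smul sx sy 0) sxy mulr0 mul0r.
rewrite smulS sxy mulr0 mul0r add0r -smul_sconst; apply: eq_smull => -[|m].
  by rewrite sxy mulr1.
by rewrite sxy mulr0.
Qed.

Lemma sB0 f g : sB f g 0%N = 0.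
Proof. by rewrite /sB (eq_smull _ (smul_xy f)) /smul big_ord1 mul0r. Qed.

Lemma sBS f g n :
  sB f g n.+1 = 'X * \sum_(i <- iota 0 n.+1)
    f i * div_x1 (ssub (smul sx g) (at_x1 g)) (n - i)%N.
Proof.
rewrite /sB (eq_smull _ (smul_xy f)) smulS mul0r add0r /smul mulr_sumr.
rewrite -[iota _ _]/(index_iota 0 n.+1) big_mkord.
by apply: eq_bigr => i _; rewrite mulrA.
Qed.

Theorem theorem3p2 : Phi =1 sadd (sB Phi Phi) (sconst 1).
Proof.
case=> [|n]; rewrite /sadd /sconst /=.
  by rewrite sB0 add0r Phi_intervals (perm_big _ perm_intervals0) big_seq1.
rewrite addr0 Phi_intervals -(perm_big _ (perm_glue n)) big_map sBS.
rewrite !big_allpairs_dep mulr_sumr; apply: eq_bigr => i _.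
rewrite (div_x1_monomials (Phi_intervals _)) Phi_intervals.
rewrite mulr_suml mulr_sumr big_allpairs; apply: eq_bigr => -[r r'] _.
rewrite !mulr_sumr; apply: eq_bigr => -[s b'] _.
rewrite !mulr_sumr; apply: eq_big_seq => j.
rewrite mem_iota ltnS => js.
by rewrite leftmost_glue // exprS exprD.
Qed.
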